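(* Let $X$ be an infinite-dimensional separable real Banach space endowed with a centered non-degenerate Gaussian measure $\gamma$, with Cameron–Martin space $H$, and let $\Omega\subset X$ be an open convex set. Let $(T^\Omega(t))_{t\ge 0}$ be the Ornstein–Uhlenbeck semigroup. Then for all $f,g\in L^2(\Omega,\gamma)$ and all $t\ge 0$, $$\left[T^{\Omega}(t)(fg)\right]^2\leq T^{\Omega}(t)(f^2)\; T^{\Omega}(t)(g^2)\quad \text{a.e. in }\Omega.$$
   Context: Cameron–Martin space: $X^*_\gamma$ is the closure of $X^*$ in $L^2(X,\gamma)$; $R_\gamma:X^*_\gamma\to X$ is determined by $g(R_\gamma f)=\int_X f g\,d\gamma$ for all $g\in X^*$; $H=R_\gamma(X^*_\gamma)$. For $h\in H$, $\hat h\in X^*_\gamma$ is the element with $h=R_\gamma\hat h$, and $\langle h,k\rangle_H=\int_X\hat h\,\hat k\,d\gamma$. $H$ is a separable Hilbert space continuously embedded in $X$. Cylindrical functions: $\mathcal{F}C^k_b(X)$ is the set of functions $f(x)=\varphi(l_1(x),\ldots,l_n(x))$ with $n\in\mathbb N$, $\varphi\in C^k_b(\mathbb R^n)$, $l_i\in X^*$; $\mathcal{F}C^k_b(X)_{|\Omega}$ is the set of their restrictions to $\Omega$. For $f\in\mathcal{F}C^1_b(X)$, $\nabla_H f(x)$ is the unique $y\in H$ with $\langle y,h\rangle_H=f'(x)h$ for all $h\in H$. Sobolev space: the operator $\nabla_H:\mathcal{F}C^1_b(X)_{|\Omega}\to L^2(\Omega,\gamma;H)$ is closable in $L^2(\Omega,\gamma)$;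 its closure is still denoted $\nabla_H$ and the domain of the closure is $W^{1,2}(\Omega,\gamma)$, with norm $\|f\|^2=\int_\Omega f^2d\gamma+\int_\Omega|\nabla_Hf|_H^2d\gamma$. Ornstein–Uhlenbeck operator: $D(L^\Omega)$ is the set of $u\in W^{1,2}(\Omega,\gamma)$ for which there is $f\in L^2(\Omega,\gamma)$ with $\int_\Omega\langle\nabla_Hu,\nabla_Hv\rangle_Hd\gamma=-\int_\Omega fv\,d\gamma$ for all $v\in W^{1,2}(\Omega,\gamma)$, and $L^\Omega u=f$. $L^\Omega$ is self-adjoint and dissipative in $L^2(\Omega,\gamma)$, and $(T^\Omega(t))_{t\ge0}$ denotes the analytic contraction semigroup it generates in $L^2(\Omega,\gamma)$. Since $fg,f^2,g^2$ are in general only in $L^1(\Omega,\gamma)$, $T^\Omega(t)$ applied to them denotes the unique continuous extension of $T^\Omega(t)$ from $L^2(\Omega,\gamma)$ to a contraction of $L^1(\Omega,\gamma)$ (which exists because $T^\Omega(t)$ is symmetric and sub-markovian). *)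

(* Defs.v *)
From HB Require Import structures.
From mathcomp Require Import all_boot all_order all_algebra.
From mathcomp Require Import all_classical all_reals all_analysis.

Set Implicit Arguments.
Unset Strict Implicit.
Unset Printing Implicit Defensive.
Import Order.TTheory GRing.Theory Num.Theory.
Import numFieldNormedType.Exports.
Local Open Scope classical_set_scope.
Local Open Scope ring_scope.

Notation borel X := (g_sigma_algebraType (@open X)).

Lemma borel_open (R : realType) (X : normedModType R) (A : set X) :
  open A -> measurable (A : set (borel X)).
Proof. exact: sub_sigma_algebra. Qed.

Section banach.
Context (R : realType) (X : normedModType R).

Definition separable_space := exists2 D : set X, countable D & dense D.

Definition finite_dimensional := exists (n : nat) (e : 'I_n -> X),
  forall x, exists c : 'I_n -> R, x = \sum_(i < n) c i *: e i.

Definition topdual : set (X -> R) := [set l : X -> R | scalar l /\ continuous l].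

Definition C1b (n : nat) (phi : 'rV[R]_n -> R) :=
  [/\ forall y, differentiable phi y,
      exists M, forall y, `|phi y| <= M &
      forall i : 'I_n, continuous ('D_(delta_mx 0 i) phi) /\
        exists M, forall y, `|'D_(delta_mx 0 i) phi y| <= M].

Definition FC1b : set (X -> R) := [set f | exists n (phi : 'rV[R]_n -> R)
    (l : 'I_n -> X -> R),
  [/\ C1b phi, forall i, topdual (l i) & f = fun x => phi (\row_i l i x)]].

End banach.

Section Lp_operators.
Context d (T : measurableType d) (R : realType).
Variable mu : {measure set T -> \bar R}.

Definition normLp (p : \bar R) (f : T -> R) : \bar R := Lnorm mu p (EFin \o f).

(* Elements of L^p are represented by functions, operators on L^p by maps on
   functions that are compatible with equality a.e. *)
Definition Lcontraction (p : \bar R) (A : (T -> R) -> T -> R) :=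
  [/\ {in Lfun mu p, forall f, A f \in Lfun mu p},
      {in Lfun mu p &, forall f g, f = g %[ae mu] -> A f = A g %[ae mu]},
      forall a, {in Lfun mu p &, forall f g,
        A (a \*: f \+ g) = a \*: A f \+ A g %[ae mu]} &
      {in Lfun mu p, forall f,
        (normLp p (A f) <= normLp p f)%E}].

Definition contraction_semigroup (A : R -> (T -> R) -> T -> R) :=
  [/\ forall t, 0 <= t -> Lcontraction 2%:E (A t),
      {in Lfun mu 2%:E, forall f, A 0 f = f %[ae mu]},
      forall s t, 0 <= s -> 0 <= t ->
        {in Lfun mu 2%:E, forall f, A (s + t) f = A s (A t f) %[ae mu]} &
      {in Lfun mu 2%:E, forall f,
        normLp 2%:E (A t f \- f) @[t --> 0^'+] --> 0%E}].

Definition infinitesimal_generator (A : R -> (T -> R) -> T -> R) (u f : T -> R) :=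
  [/\ u \in Lfun mu 2%:E, f \in Lfun mu 2%:E &
      normLp 2%:E (t^-1 \*: (A t u \- u) \- f) @[t --> 0^'+] --> 0%E].

Definition L1_extension (A B : (T -> R) -> T -> R) :=
  Lcontraction 1 B /\ {in Lfun mu 2%:E, forall f, B f = A f %[ae mu]}.

End Lp_operators.

Section gaussian.
Context (R : realType) (X : normedModType R).
Variable gamma : probability (borel X) R.

Definition law (l : X -> R) : set (measurableTypeR R) -> \bar R :=
  pushforward gamma (l : borel X -> measurableTypeR R).

(* The value of [normal_prob 0 0] in the library is not the Dirac mass. *)
Definition centered_gaussian := forall l : X -> R, topdual l ->
  exists2 s : R, 0 <= s & forall B : set (measurableTypeR R), measurable B ->
    law l B = if s == 0 then \d_(0 : R) B else normal_prob 0 s B.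

Definition nondegenerate_gaussian := forall l : X -> R, topdual l -> (exists x, l x != 0) ->
  ~ exists a : R, forall B : set (measurableTypeR R), measurable B ->
      law l B = \d_a B.

Definition Xstar_gamma : set (X -> R) := [set f | f \in Lfun gamma 2%:E /\
  forall e : R, 0 < e ->
    exists2 l, topdual l & (normLp gamma 2%:E (f \- l)%R < e%:E)%E].

Definition is_Rgamma (f : X -> R) (h : X) := forall g, topdual g ->
  g h = \int[gamma]_(x in setT) (f x * g x).

Definition CM : set X := [set h | exists2 f, Xstar_gamma f & is_Rgamma f h].

(* A representative; it is unique up to equality gamma-a.e. *)
Definition hat (h : X) : X -> R :=
  xget (cst 0) [set f | Xstar_gamma f /\ is_Rgamma f h].

Definition dotH (h k : X) : R := \int[gamma]_(x in setT) (hat h x * hat k x).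

Definition normH (h : X) : R := Num.sqrt (dotH h h).

Definition is_gradH (f : X -> R) (x y : X) :=
  CM y /\ forall h, CM h -> dotH y h = 'd f x h.

Definition openH (U : set X) := forall h, CM h -> U h ->
  exists2 r : R, 0 < r & forall k, CM k -> normH (k - h) < r -> U k.

(* L^2(mu; H): since H is separable, Bochner measurability is Borel
   measurability with respect to the norm of H. *)
Definition L2H (mu : {measure set (borel X) -> \bar R}) : set (X -> X) :=
  [set F | [/\ forall x, CM (F x),
      forall U, openH U -> measurable (F @^-1` U : set (borel X)) &
      (\int[mu]_x (normH (F x) ^+ 2)%:E < +oo)%E]].

End gaussian.

Section ornstein_uhlenbeck.
Context (R : realType) (X : normedModType R).
Variables (gamma : probability (borel X) R) (Omega : set X).
Hypothesis oO : open Omega.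

(* L^p(Omega, gamma) is [Lfun restr p]: this measure does not charge the
   complement of Omega. *)
Definition restr : {measure set (borel X) -> \bar R} :=
  mrestr gamma (borel_open oO).

(* u is in W^{1,2}(Omega, gamma) with gradient F: (u, F) lies in the closure of
   the graph of the gradient on restrictions of cylindrical functions. *)
Definition W12_grad (u : X -> R) (F : X -> X) :=
  [/\ u \in Lfun restr 2%:E, L2H gamma restr F &
      exists (f_ : nat -> X -> R) (F_ : nat -> X -> X),
      [/\ forall n, FC1b (f_ n),
          forall n x, Omega x -> is_gradH gamma (f_ n) x (F_ n x),
          normLp restr 2%:E (f_ n \- u) @[n --> \oo] --> 0%E &
          (\int[restr]_x (normH gamma (F_ n x - F x) ^+ 2)%:E)%E
            @[n --> \oo] --> 0%E]].

Definition OU_operator (u f : X -> R) :=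
  f \in Lfun restr 2%:E /\
  exists2 F, W12_grad u F & forall v G, W12_grad v G ->
    \int[restr]_(x in setT) dotH gamma (F x) (G x) =
    - \int[restr]_(x in setT) (f x * v x).

(* A strongly continuous semigroup is determined by its generator; analyticity
   follows from self-adjointness and is not imposed. *)
Definition OU_semigroup (T : R -> (X -> R) -> X -> R) :=
  contraction_semigroup restr T /\
  forall u f, infinitesimal_generator restr T u f <-> OU_operator u f.

End ornstein_uhlenbeck.

(* Main.v *)
Require Import Defs.
From mathcomp Require Import all_boot all_order all_algebra.
From mathcomp Require Import all_classical all_reals all_analysis.
From mathcomp Require Import measurable_realfun lra ring.
Import Order.TTheory GRing.Theory Num.Theory.
Import numFieldNormedType.Exports.
Local Open Scope classical_set_scope.
Local Open Scope ring_scope.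

(** The Cauchy-Schwarz inequality holds a.e. for every linear operator on L^1
that maps nonnegative functions to nonnegative functions: for each rational q
the function (f + q g)^2 is nonnegative, so expanding its image gives
T(f^2) + 2 q T(fg) + q^2 T(g^2) >= 0 a.e.; there are countably many q, so a.e.
the quadratic polynomial is nonnegative at all rationals, and its discriminant
is nonpositive ([unital_Lcontraction_Cauchy_Schwarz]).

Positivity comes from two facts, contractivity on L^1 and T 1 = 1. If
0 <= h <= M and k = M - h, then T h + T k = M, hence
  |T h|_1 + |T k|_1 <= |h|_1 + |k|_1 = int (h + k) = int (T h + T k),
which forces T h = |T h| a.e. ([unital_Lcontraction_bounded_ge0]). On a finite
measure space this extends to all nonnegative integrable h by truncation
([unital_Lcontraction_ge0]).

Finally, T(t) 1 = 1 because the constant 1 has zero gradient, so it lies in the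
domain of the Ornstein-Uhlenbeck operator with image 0 ([OU_operator_cst]), and a
contraction semigroup fixes the kernel of its generator: the contraction
property gives |T(t) u - u| <= n |T(t / n) u - u|, which tends to 0
when the derivative of T(s) u at s = 0 vanishes ([generator_kernel_fixed]). *)

(** * A discriminant criterion on the rationals *)

(** By density and continuity the polynomial is nonnegative on the whole line.
Rational points keep the number of conditions countable, so that each of them
may be given only up to a null set. *)
Lemma discriminant_le0_rat (R : realType) (a b c : R) :
  (forall q : rat, 0 <= 2 * ratr q * b + (ratr q ^+ 2 * c + a)) -> b ^+ 2 <= a * c.
Proof.
move=> pos_rat; set p := fun l : R => 2 * l * b + (l ^+ 2 * c + a).
have pos l : 0 <= p l.
  rewrite leNgt; apply/negP => pl0.
  have cp : continuous p.
    move=> z; apply: cvgD.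
      by apply: cvgMl; apply: cvgMr; exact: cvg_id.
    apply: cvgD; last exact: cvg_cst.
    by apply: cvgMl; apply: exprn_continuous.
  have opp : open [set z | p z < 0].
    by apply: (@open_comp _ _ p [set y | y < 0]) => // z _; exact: cp.
  have [|y []] := @dense_rat R [set z | p z < 0] _ opp; first by exists l.
  by rewrite /= ltNge => py [q _ qE]; move: py; rewrite -qE pos_rat.
pose q := Poly [:: a; 2 * b; c].
have size3 : (size q <= 3)%N by exact: size_Poly.
have := deg_le2_poly_ge0 size3; rewrite !coef_Poly /= => disc.
suff : (2 * b) ^+ 2 - 4 * c * a <= 0 by nra.
by apply: disc => x; have := pos x; rewrite horner_Poly /= /p; lra.
Qed.

(** * Integrals of L^p functions *)

Section Lp_functions.
Context {d} {T : measurableType d} {R : realType}.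
Context {mu : {measure set T -> \bar R}}.
Local Notation L1 := (Lfun mu 1).

Lemma Lfun_measurable {p : \bar R} {f : T -> R} :
  f \in Lfun mu p -> measurable_fun setT f.
Proof. by rewrite inE => /andP[]; rewrite inE. Qed.

Lemma Lfun_linear {p : \bar R} a {f g : T -> R} : (1 <= p)%E ->
  f \in Lfun mu p -> g \in Lfun mu p -> a \*: f \+ g \in Lfun mu p.
Proof. by move=> p1 fL gL; apply: (Lfun_submod_closed mu p1).2. Qed.

Lemma LfunD {p : \bar R} {f g : T -> R} : (1 <= p)%E ->
  f \in Lfun mu p -> g \in Lfun mu p -> f \+ g \in Lfun mu p.
Proof.
move=> p1 fL gL; have := (Lfun_submod_closed mu p1).2 1 _ _ fL gL.
by rewrite scale1r.
Qed.

Lemma LfunB {p : \bar R} {f g : T -> R} : (1 <= p)%E ->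
  f \in Lfun mu p -> g \in Lfun mu p -> f \- g \in Lfun mu p.
Proof.
move=> p1 fL gL; have := (Lfun_submod_closed mu p1).2 (-1) _ _ gL fL.
by rewrite scaleN1r addrC.
Qed.

Lemma ae_eq0_Rintegral_le0 {f : T -> R} : f \in L1 -> (forall x, 0 <= f x) ->
  \int[mu]_(x in setT) f x <= 0 -> \forall x \ae mu, f x = 0.
Proof.
move=> /Lfun1_integrable fi f0 intf.
have : (\int[mu]_x `|(EFin \o f) x| = 0)%E.
  under eq_integral do rewrite /= ger0_norm//.
  apply/eqP; rewrite eq_le integral_ge0 ?andbT; last by move=> x _; rewrite lee_fin.
  by rewrite -[leLHS]fineK ?lee_fin//; exact: integrable_fin_num.
move/ae_eq_integral_abs => /(_ measurableT (measurable_int _ fi)).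
by apply: filterS => x /= /(_ I) [].
Qed.

Lemma eq_ae_Rintegral (f g : T -> R) : f \in L1 -> g \in L1 -> f = g %[ae mu] ->
  \int[mu]_(x in setT) f x = \int[mu]_(x in setT) g x.
Proof.
move=> /Lfun1_integrable fi /Lfun1_integrable gi fg; congr fine.
apply: ae_eq_integral => //; [exact: (measurable_int _ fi)|exact: (measurable_int _ gi)|].
by apply: filterS fg => x /= /[apply] ->.
Qed.

Lemma ae_le_Rintegral {f g : T -> R} : f \in L1 -> g \in L1 ->
  (forall x, 0 <= f x) -> (forall x, 0 <= g x) -> {ae mu, forall x, f x <= g x} ->
  \int[mu]_(x in setT) f x <= \int[mu]_(x in setT) g x.
Proof.
move=> /Lfun1_integrable fi /Lfun1_integrable gi f0 g0 fg.
apply: fine_le; [exact: integrable_fin_num|exact: integrable_fin_num|].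
apply: ae_ge0_le_integral => //.
- by move=> x _; rewrite lee_fin.
- exact: (measurable_int _ fi).
- by move=> x _; rewrite lee_fin.
- exact: (measurable_int _ gi).
- by apply: filterS fg => x /=; rewrite lee_fin.
Qed.

Lemma eq_ae_normLp {r : R} {f g : T -> R} :
  f \in Lfun mu r%:E -> g \in Lfun mu r%:E -> f = g %[ae mu] ->
  normLp mu r%:E f = normLp mu r%:E g.
Proof.
move=> fL gL fg.
have mpow h : h \in Lfun mu r%:E ->
    measurable_fun setT (fun x => (`|(EFin \o h) x| `^ r)%E).
  move=> hL; apply: (measurableT_comp (measurable_poweR _)) => //.
  by apply/measurableT_comp/measurable_EFinP => //; exact: Lfun_measurable hL.
rewrite /normLp unlock; congr (_ `^ _)%E.
apply: ae_eq_integral => //; [exact: mpow|exact: mpow|].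
by apply: filterS fg => x /= /[apply] ->.
Qed.

Lemma Rintegral_truncation_error {h : T -> R} : h \in L1 -> (forall x, 0 <= h x) ->
  (\int[mu]_(x in setT) (h x - Num.min (h x) n%:R)) @[n --> \oo] --> 0.
Proof.
move=> /Lfun1_integrable hi h0; apply: fine_cvg.
have mh : measurable_fun setT h by exact/measurable_EFinP/(measurable_int _ hi).
have -> : 0%:E = (\int[mu]_(x in setT) cst 0 x)%E by rewrite integral0.
apply: (@dominated_cvg _ _ _ mu setT measurableT
    (fun n x => (h x - Num.min (h x) n%:R)%:E) (cst 0%E) (EFin \o h)) => //=.
- move=> n; apply/measurable_EFinP; apply: measurable_funB => //.
  by apply: measurable_minr.
- move=> x _; apply: cvg_near_cst; near=> n.
  rewrite min_l ?subrr//; near: n; exact: nbhs_infty_ger.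
- move=> n x _ /=; rewrite lee_fin ger0_norm ?subr_ge0 ?ge_min ?lexx//.
  by rewrite gerBl le_min h0 ler0n.
Unshelve. all: by end_near. Qed.

Lemma Rintegral_norm_ge0 {f : T -> R} : (forall x, 0 <= f x) ->
  \int[mu]_(x in setT) `|f x| = \int[mu]_(x in setT) f x.
Proof. by move=> f0; apply: eq_Rintegral => x _; exact: ger0_norm. Qed.

Lemma Lcontraction_Rintegral {B : (T -> R) -> T -> R} {f : T -> R} :
  Lcontraction mu 1 B -> f \in L1 ->
  \int[mu]_(x in setT) `|B f x| <= \int[mu]_(x in setT) `|f x|.
Proof.
move=> [BL _ _ Bn] fL; have := Bn _ fL; rewrite /normLp !Lnorm1 => h.
have fin g : g \in L1 -> (\int[mu]_x `|(EFin \o g) x|)%E \is a fin_num.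
  move=> /Lfun1_integrable gi; apply: integrable_fin_num => //.
  exact: integrable_abse gi.
by apply: fine_le h; apply: fin => //; exact: BL.
Qed.

End Lp_functions.

(** * Unital contractions of L^1 are positive *)

Section unital_L1_contraction.
Context {d} {T : measurableType d} {R : realType}.
Context {mu : {finite_measure set T -> \bar R}}.
Local Notation L1 := (Lfun mu 1).
Variable B : (T -> R) -> T -> R.
Hypotheses (contrB : Lcontraction mu 1 B) (B1 : B (cst 1) = cst 1 %[ae mu]).

Let L1_B {f} : f \in L1 -> B f \in L1.
Proof. by case: contrB => + _ _ _; exact. Qed.

Let B_linear a {f g} : f \in L1 -> g \in L1 ->
  B (a \*: f \+ g) = a \*: B f \+ B g %[ae mu].
Proof. by case: contrB => _ _ + _ => /[apply] /[apply]; exact. Qed.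

Let L1_cst c : cst c \in L1. Proof. exact: Lfun_cst. Qed.

Lemma unital_Lcontraction_cst M : B (cst M) = cst M %[ae mu].
Proof.
have -> : cst M = (M - 1) \*: cst 1 \+ cst 1 :> (T -> R).
  by apply/funext => x /=; rewrite /GRing.scale/= mulr1 subrK.
by apply: filterS2 (B_linear (M - 1) (L1_cst 1) (L1_cst 1)) B1 =>
  x /= + + xT => /(_ xT) -> /(_ xT) ->.
Qed.

(** Both h and M - h are nonnegative, with constant sum: the L^1 norms of their
images can add up to no more than the integral of that constant, which leaves no
room for negative values. *)
Lemma unital_Lcontraction_bounded_ge0 {h} M : h \in L1 ->
  (forall x, 0 <= h x <= M) -> {ae mu, forall x, 0 <= B h x}.
Proof.
move=> hL h0M; pose k := (-1) \*: h \+ cst M.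
have kE x : k x = M - h x by rewrite /k /= /GRing.scale/= mulN1r addrC.
have kL : k \in L1 by exact: Lfun_linear.
have sumB : {ae mu, forall x, B h x + B k x = M}.
  have hk : 1 \*: h \+ k = cst M.
    by apply/funext => x /=; rewrite kE scale1r subrKC.
  have := B_linear 1 hL kL; rewrite hk.
  apply: filterS2 (unital_Lcontraction_cst M) => x /= /(_ I) -> /(_ I) ->.
  by rewrite scale1r.
have defectL f : f \in L1 -> (Num.norm \o f) \- f \in L1.
  by move=> fL; apply: LfunB => //; exact: Lfun_norm.
(* F is twice the sum of the negative parts of B h and B k. *)
pose F := ((Num.norm \o B h) \- B h) \+ ((Num.norm \o B k) \- B k).
have FL : F \in L1.
  by apply: LfunD => //; apply: defectL; exact: L1_B.
have F0 x : 0 <= F x by rewrite /F addr_ge0 // subr_ge0 ler_norm.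
have intF : \int[mu]_(x in setT) F x <= 0.
  rewrite RintegralD//; try by apply/Lfun1_integrable; exact/defectL/L1_B.
  rewrite !RintegralB//; try exact/Lfun1_integrable/Lfun_norm/L1_B; try exact/Lfun1_integrable/L1_B.
  have sumint : \int[mu]_(x in setT) B h x + \int[mu]_(x in setT) B k x =
      \int[mu]_(x in setT) h x + \int[mu]_(x in setT) k x.
    rewrite -!RintegralD//; try exact/Lfun1_integrable/L1_B; try exact/Lfun1_integrable.
    apply: eq_ae_Rintegral.
    - by apply: LfunD => //; exact: L1_B.
    - exact: LfunD.
    - by apply: filterS sumB => x /= -> _; rewrite kE subrKC.
  have contr f : f \in L1 -> (forall x, 0 <= f x) ->
      \int[mu]_(x in setT) `|B f x| <= \int[mu]_(x in setT) f x.
    move=> fL f0; apply: le_trans (Lcontraction_Rintegral contrB fL) _.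
    by rewrite Rintegral_norm_ge0.
  have hh : forall x, 0 <= h x by move=> x; case/andP: (h0M x).
  have kk : forall x, 0 <= k x by move=> x; rewrite kE subr_ge0; case/andP: (h0M x).
  rewrite addrACA -opprD sumint subr_le0.
  exact: lerD (contr _ hL hh) (contr _ kL kk).
apply: filterS (ae_eq0_Rintegral_le0 FL F0 intF) => x Fx.
have := normr_ge0 (B h x); have := ler_norm (B h x); have := ler_norm (B k x).
by move: Fx; rewrite /F /=; lra.
Qed.

(** The bounded case applies to the truncation t n = min(h, n), so the negative
part of B h is controlled by B (h - t n), whose L^1 norm tends to 0. *)
Lemma unital_Lcontraction_ge0 {h} : h \in L1 -> (forall x, 0 <= h x) ->
  {ae mu, forall x, 0 <= B h x}.
Proof.
move=> hL h0; pose t n x := Num.min (h x) n%:R.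
have mh := Lfun_measurable hL.
have tL n : t n \in L1.
  have /Lfun1_integrable hi := hL.
  apply/Lfun1_integrable; apply: le_integrable hi => //.
    by apply/measurable_EFinP; exact: measurable_minr.
  move=> x _ /=; rewrite lee_fin !ger0_norm ?le_min ?h0 ?ler0n//.
  by rewrite ge_min lexx.
have rL n : h \- t n \in L1 by exact: LfunB.
have r0 n x : 0 <= (h \- t n) x by rewrite subr_ge0 ge_min lexx.
pose D := (Num.norm \o B h) \- B h.
have DL : D \in L1 by apply: LfunB; [|exact: Lfun_norm (L1_B hL)|exact: L1_B].
have D0 x : 0 <= D x by rewrite subr_ge0 ler_norm.
have DB n : {ae mu, forall x,
    D x <= ((Num.norm \o B (h \- t n)) \+ (Num.norm \o B (h \- t n))) x}.
  have hE : 1 \*: t n \+ (h \- t n) = h.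
    by apply/funext => x /=; rewrite scale1r subrKC.
  have := B_linear 1 (tL n) (rL n); rewrite hE.
  have t0 x : 0 <= t n x <= n%:R by rewrite le_min h0 ler0n ge_min lexx orbT.
  apply: filterS2 (unital_Lcontraction_bounded_ge0 n%:R (tL n) t0) => x p /(_ I).
  rewrite /D /= scale1r => ->.
  have := ler_normD (B (t n) x) (B (h \- t n) x); rewrite (ger0_norm p).
  by have := ler_norm (- B (h \- t n) x); rewrite normrN; lra.
have intD n : \int[mu]_(x in setT) D x <=
    \int[mu]_(x in setT) (h x - t n x) + \int[mu]_(x in setT) (h x - t n x).
  have nL := Lfun_norm (L1_B (rL n)).
  apply: le_trans (ae_le_Rintegral DL (LfunD (lexx 1%E) nL nL) D0 _ (DB n)) _.
    by move=> x; rewrite addr_ge0 /=.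
  rewrite [leLHS]RintegralD//; try exact/Lfun1_integrable.
  have := Lcontraction_Rintegral contrB (rL n).
  rewrite [leRHS]Rintegral_norm_ge0//.
  by move=> contr; exact: lerD.
have D_le0 : \int[mu]_(x in setT) D x <= 0.
  have err0 := Rintegral_truncation_error hL h0.
  rewrite -[leRHS]addr0; apply: (cvgr_to_ge (cvgD err0 err0)).
  by apply: nearW => n; exact: intD.
apply: filterS (ae_eq0_Rintegral_le0 DL D0 D_le0) => x /eqP.
by rewrite /D /= subr_eq0 => /eqP <-.
Qed.

Lemma unital_Lcontraction_Cauchy_Schwarz f g :
  f \in Lfun mu 2%:E -> g \in Lfun mu 2%:E ->
  {ae mu, forall x, B (fun y => f y * g y) x ^+ 2 <=
    B (fun y => f y ^+ 2) x * B (fun y => g y ^+ 2) x}.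
Proof.
move=> fL gL.
have ffL : (fun y => f y ^+ 2) \in L1 by exact/Lfun1_integrable/Lfun2_integrable_sqr.
have ggL : (fun y => g y ^+ 2) \in L1 by exact/Lfun1_integrable/Lfun2_integrable_sqr.
have fgL : (fun y => f y * g y) \in L1 by exact: Lfun2_mul_Lfun1.
have quad (q : rat) : {ae mu, forall x, 0 <= 2 * ratr q * B (fun y => f y * g y) x +
    (ratr q ^+ 2 * B (fun y => g y ^+ 2) x + B (fun y => f y ^+ 2) x)}.
  have inL := Lfun_linear (ratr q ^+ 2) (lexx 1%E) ggL ffL.
  have squareE : (2 * ratr q) \*: (fun y => f y * g y) \+
      ((ratr q ^+ 2) \*: (fun y => g y ^+ 2) \+ (fun y => f y ^+ 2)) =
      (fun y => (f y + ratr q * g y) ^+ 2).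
    by apply/funext => x /=; rewrite /GRing.scale/=; ring.
  have := B_linear (2 * ratr q) fgL inL.
  have := B_linear (ratr q ^+ 2) ggL ffL.
  have := Lfun_linear (2 * ratr q) (lexx 1%E) fgL inL.
  rewrite squareE => sqL.
  have := unital_Lcontraction_ge0 sqL (fun x => sqr_ge0 _).
  apply: filterS3 => x pos /(_ I) /= inner /(_ I) /= outer.
  by move: pos; rewrite outer inner.
(* Countably many null sets: the rationals are enumerated by [unpickle]. *)
have : {ae mu, forall x, forall n (q : rat), unpickle n = Some q ->
    0 <= 2 * ratr q * B (fun y => f y * g y) x +
    (ratr q ^+ 2 * B (fun y => g y ^+ 2) x + B (fun y => f y ^+ 2) x)}.
  apply/ae_foralln => n; case: (unpickle n) => [q|]; last exact: aeW.
  by apply: filterS (quad q) => x qx _ [<-].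
apply: filterS => x posx; apply: discriminant_le0_rat => q.
exact: posx _ q (pickleK q).
Qed.

End unital_L1_contraction.

(** * Semigroups fix the kernel of their generator *)

Section generator_kernel.
Context {d} {T : measurableType d} {R : realType}.
Context {mu : {measure set T -> \bar R}}.
Local Notation L2 := (Lfun mu 2%:E).
Context {A : R -> (T -> R) -> T -> R}.
Hypothesis sgA : contraction_semigroup mu A.

Let leL2 : (1 <= 2%:E :> \bar R)%E. Proof. by rewrite lee_fin ler1n. Qed.

Let contrA {t : R} : 0 <= t -> Lcontraction mu 2%:E (A t).
Proof. by case: sgA => + _ _ _; exact. Qed.

(** Telescoping: A (ks + s) u - A (ks) u = A (ks) (A s u - u), and A (ks) is a
contraction, so each of the n steps moves u by at most the first one. *)
Lemma contraction_semigroup_displacement {u} {s : R} n : u \in L2 -> 0 <= s ->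
  (normLp mu 2%:E (A (n%:R * s)%R u \- u)%R <=
    n%:R%:E * normLp mu 2%:E (A s u \- u)%R)%E.
Proof.
move=> uL s0; case: (sgA) => _ A0 Asemi _.
have AL t : 0 <= t -> A t u \in L2 by move=> t0; case: (contrA t0) => + _ _ _; exact.
elim: n => [|n IH].
  rewrite mul0r mul0e -(@Lnorm0 _ _ _ mu 2%:E) ?eqe ?pnatr_eq0//.
  have L0 : cst 0 \in L2 by exact: (Lfun_submod_closed mu leL2).1.
  rewrite -/(normLp mu 2%:E (cst 0)) (eq_ae_normLp (g := cst 0))//.
    by apply: LfunB => //; exact: AL.
  by apply: filterS (A0 _ uL) => x /= /[apply] ->; rewrite subrr.
have ns0 : 0 <= n%:R * s by rewrite mulr_ge0.
have [ALn _ linA cA] := contrA ns0.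
have dL : A s u \- u \in L2 by apply: LfunB => //; exact: AL.
rewrite (eq_ae_normLp (g := A (n%:R * s) (A s u \- u) \+ (A (n%:R * s) u \- u))).
- have -> : n.+1%:R%:E = (n%:R%:E + 1)%E :> \bar R by rewrite -EFinD natr1.
  rewrite ge0_muleDl ?lee_fin// mul1e addeC.
  apply: le_trans (minkowski_EFin _ _ _ _) _; rewrite ?ler1n//.
  + exact: Lfun_measurable (ALn _ dL).
  + by apply: Lfun_measurable; apply: LfunB leL2 _ uL; exact: AL.
  + by apply: leeD => //; exact: cA.
- by apply: LfunB => //; apply: AL; rewrite mulr_ge0.
- by apply: LfunD => //; [exact: ALn|apply: LfunB => //; exact: AL].
- have uE : 1 \*: (A s u \- u) \+ u = A s u.
    by apply/funext => x /=; rewrite scale1r subrK.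
  have := linA 1 _ _ dL uL; rewrite uE -natr1 mulrDl mul1r.
  apply: filterS2 (Asemi _ _ ns0 s0 _ uL) => x /= + + xT.
  by move=> /(_ xT) -> /(_ xT) ->; rewrite scale1r addrA.
Qed.

(** With s = t / n the displacement bound reads
|A t u - u| <= t |s^-1 (A s u - u)|, and the right-hand side tends to 0. *)
Lemma generator_kernel_fixed {u} {t : R} : infinitesimal_generator mu A u (cst 0) ->
  0 <= t -> A t u = u %[ae mu].
Proof.
move=> [uL _ gen0]; rewrite le_eqVlt => /predU1P[<-|t0].
  by case: sgA => _ + _ _; exact.
have AL s : 0 <= s -> A s u \in L2 by move=> s0; case: (contrA s0) => + _ _ _; exact.
have dL : A t u \- u \in L2 by apply: LfunB => //; exact/AL/ltW.
have normZ s : 0 < s -> (normLp mu 2%:E (s^-1 \*: (A s u \- u) \- cst 0)%R =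
    (s^-1)%:E * normLp mu 2%:E (A s u \- u)%R)%E.
  move=> s0; have dsL : A s u \- u \in L2 by apply: LfunB => //; exact/AL/ltW.
  have -> : s^-1 \*: (A s u \- u) \- cst 0 = s^-1 \*: (A s u \- u).
    by apply/funext => x /=; rewrite subr0.
  have := LnormZ (Lfun_Sub leL2 dsL) s^-1.
  by rewrite gtr0_norm ?invr_gt0.
have norm0 : (normLp mu 2%:E (A t u \- u)%R <= 0)%E.
  have step0 : (t / n.+1%:R) @[n --> \oo] --> (0 : R).
    by rewrite -(mulr0 t); apply: cvgMl_tmp; exact: cvg_harmonic.
  have genseq := (cvge_at_rightP _ 0 0).1 gen0 (fun n => t / n.+1%:R)
    (conj (fun n => divr_gt0 t0 (ltr0Sn R n)) step0).
  have : (t%:E * 0 >= normLp mu 2%:E (A t u \- u)%R)%E; last by rewrite mule0.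
  apply: (cvge_to_ge (cvgeZl (isT : t%:E \is a fin_num) genseq)) => //.
  near=> n => /=.
  rewrite normZ ?divr_gt0// muleA -EFinM.
  have -> : t * (t / n.+1%:R)^-1 = n.+1%:R by rewrite invf_div mulrCA divff ?mulr1 ?gt_eqF.
  rewrite -[in leLHS](_ : n.+1%:R * (t / n.+1%:R) = t).
    by apply: contraction_semigroup_displacement => //; rewrite divr_ge0// ltW.
  by rewrite mulrC divfK ?pnatr_eq0.
have norm_eq0 : normLp mu 2%:E (A t u \- u) = 0%E.
  by apply/eqP; rewrite eq_le norm0 Lnorm_ge0.
have /measurable_EFinP mE := Lfun_measurable dL.
have := Lnorm_eq0_eq0 mE _ norm_eq0; rewrite lte_fin ltr0n => /(_ isT).
by apply: filterS => x /= /[apply] -[] /eqP; rewrite subr_eq0 => /eqP.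
Unshelve. all: by end_near. Qed.

End generator_kernel.

(** * Constants lie in the kernel of the Ornstein-Uhlenbeck operator *)

Section constants.
Context {R : realType} {X : normedModType R}.
Variables (gamma : probability (borel X) R) (Omega : set X).
Hypothesis oO : open Omega.

Lemma Xstar_gamma0 : Xstar_gamma gamma (cst 0).
Proof.
have L0 : cst 0 \in Lfun gamma 2%:E by exact: Lfun_cst.
split=> // e e0; exists (cst 0).
  by split=> [a x y|]; [rewrite /= mulr0 addr0|exact: cst_continuous].
rewrite (_ : _ \- _ = cst 0); last by apply/funext => x /=; rewrite subrr.
by rewrite [ltLHS](@Lnorm0 _ _ _ gamma 2%:E) ?lte_fin// eqe pnatr_eq0.
Qed.

Lemma topdual_at0 (l : X -> R) : topdual l -> l 0 = 0.
Proof. by move=> [lin _]; have := lin (-1) 0 0; rewrite scaler0 addr0 mulN1r addNr. Qed.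

Lemma CM0 : CM gamma 0.
Proof.
exists (cst 0); first exact: Xstar_gamma0.
move=> l lX; rewrite topdual_at0//.
by rewrite (@eq_Rintegral _ _ _ _ _ (cst 0)) ?Rintegral_cst ?mul0r// => x _; rewrite mul0r.
Qed.

Lemma hatP {h} : CM gamma h ->
  Xstar_gamma gamma (hat gamma h) /\ is_Rgamma gamma (hat gamma h) h.
Proof.
move=> [f fX fh]; pose S := [set f | Xstar_gamma gamma f /\ is_Rgamma gamma f h].
exact: (@xgetPex _ (cst 0) S (ex_intro _ f (conj fX fh))).
Qed.

Lemma continuous_borel_measurable (l : X -> R) : continuous l ->
  measurable_fun (setT : set (borel X)) l.
Proof.
move=> /continuousP cl mT; apply: (measurability _ (RGenOpens.measurableE R) _ mT).
move=> _ [_ [a [b ->] <-]]; rewrite setTI.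
by apply: borel_open; exact/cl/interval_open.
Qed.

(** The inner product with g is continuous on L^2 and functionals are dense in
their closure, so Hoelder's inequality carries orthogonality over to f. *)
Lemma Xstar_gamma_orthogonal g f :
  g \in Lfun gamma 2%:E -> (forall l, topdual l -> \int[gamma]_(x in setT) (g x * l x) = 0) ->
  Xstar_gamma gamma f -> \int[gamma]_(x in setT) (g x * f x) = 0.
Proof.
move=> gL gort [fL fapp].
have normg : normLp gamma 2%:E g \is a fin_num.
  by rewrite ge0_fin_numE ?Lnorm_ge0//; move: gL; rewrite inE => /andP[_]; rewrite inE.
pose K := fine (normLp gamma 2%:E g).
have K0 : 0 <= K by rewrite fine_ge0 ?Lnorm_ge0.
apply/eqP; rewrite -normr_le0; apply/ler_addgt0Pr => e e0; rewrite add0r.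
(* The tolerance makes K |f - l|_2 at most e; K + 1 avoids dividing by 0. *)
have [|l lX fl] := fapp (e / (K + 1)); first by rewrite divr_gt0// ltr_wpDl.
have ml : measurable_fun (setT : set (borel X)) l.
  by case: lX => _; exact: continuous_borel_measurable.
have le1_2 : (1 <= 2%:E :> \bar R)%E by rewrite lee_fin ler1n.
have flL : f \- l \in Lfun gamma 2%:E.
  rewrite inE; apply/andP; rewrite !inE; split.
    by apply: measurable_funB => //; exact: Lfun_measurable fL.
  by apply: lt_le_trans fl _; exact: leey.
have lL : l \in Lfun gamma 2%:E.
  have lE : f \- (f \- l) = l by apply/funext => x /=; rewrite subKr.
  by have := LfunB le1_2 fL flL; rewrite lE.
have prodI u v : u \in Lfun gamma 2%:E -> v \in Lfun gamma 2%:E ->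
    gamma.-integrable setT (EFin \o (u \* v)).
  by move=> uL vL; exact/Lfun1_integrable/Lfun2_mul_Lfun1.
have -> : \int[gamma]_(x in setT) (g x * f x) =
    \int[gamma]_(x in setT) (g \* (f \- l)) x.
  rewrite -[RHS]addr0 -(gort l lX) -RintegralD//; [|exact: prodI..].
  by apply: eq_Rintegral => x _ /=; lra.
apply: le_trans (le_normr_Rintegral measurableT (prodI _ _ gL flL)) _.
rewrite -lee_fin fineK; last first.
  by apply: integrable_fin_num => //; exact: integrable_abse (prodI _ _ gL flL).
have := @hoelder _ _ _ gamma g (f \- l) 2 2
  (Lfun_measurable gL) (Lfun_measurable flL).
rewrite Lnorm1 => holder.
apply: le_trans (holder _ _ _) _ => //; first by rewrite [RHS]splitr !div1r.
apply: le_trans (lee_pmul (Lnorm_ge0 _ _ _) (Lnorm_ge0 _ _ _) (lexx _) (ltW fl)) _.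
rewrite -/(normLp gamma 2%:E g) -(fineK normg) -EFinM lee_fin -/K.
rewrite mulrA ler_pdivrMr ?ltr_wpDl// mulrC ler_pM2l//; lra.
Qed.

(** The representative chosen by [hat] for 0 may be nonzero on a null set; it is only
known to be orthogonal to every functional. *)
Lemma dotH0l h : CM gamma h -> dotH gamma 0 h = 0.
Proof.
move=> /hatP[hX _]; have [[g0L _] g0R] := hatP CM0.
apply: Xstar_gamma_orthogonal => // l lX.
by rewrite -g0R// topdual_at0.
Qed.

Lemma normH0 : normH gamma 0 = 0.
Proof. by rewrite /normH dotH0l ?sqrtr0//; exact: CM0. Qed.

Lemma FC1b_cst (c : R) : FC1b (cst c : X -> R).
Proof.
(* A constant is cylindrical on no functionals at all: 'rV_0 is a point. *)
exists 0%N, (cst c), (fun i x => 0); split => //; last by case.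
split=> [y|| []//]; first exact: differentiable_cst.
by exists `|c|.
Qed.

Lemma L2H_cst0 (mu : {measure set (borel X) -> \bar R}) : L2H gamma mu (cst 0).
Proof.
split=> [x|U _|]; first exact: CM0.
  by rewrite preimage_cst; case: ifP.
rewrite (_ : (fun x => _) = cst 0%E); last by apply/funext => x; rewrite /= normH0 expr0n.
by rewrite integral0 ltry.
Qed.

Let L2_cst (c : R) : cst c \in Lfun (restr gamma oO) 2%:E.
Proof. exact: (@Lfun_cst _ _ _ (mrestr gamma (borel_open oO))). Qed.

Lemma W12_grad_cst (c : R) : W12_grad gamma oO (cst c) (cst 0).
Proof.
split; [exact: L2_cst|exact: L2H_cst0|].
exists (fun _ => cst c), (fun _ => cst 0); split.
- by move=> _; exact: FC1b_cst.
- move=> _ x _; split; [exact: CM0|move=> h hH].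
  by rewrite dotH0l// diff_cst.
- apply: cvg_near_cst; apply: nearW => n.
  rewrite (_ : _ \- _ = cst 0); last by apply/funext => x /=; rewrite subrr.
  by rewrite [LHS](@Lnorm0 _ _ _ (restr gamma oO) 2%:E)// eqe pnatr_eq0.
- apply: cvg_near_cst; apply: nearW => n.
  rewrite (_ : (fun x => _) = cst 0%E) ?integral0//.
  by apply/funext => x; rewrite /= subrr normH0 expr0n.
Qed.

Lemma OU_operator_cst (c : R) : OU_operator gamma oO (cst c) (cst 0).
Proof.
split; first exact: L2_cst.
exists (cst 0); first exact: W12_grad_cst.
move=> v G [_ [GH _ _] _].
rewrite !(@eq_Rintegral _ _ _ _ _ (cst 0)) ?Rintegral_cst ?mul0r ?oppr0//.
- by move=> x _; rewrite mul0r.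
- by move=> x _; rewrite dotH0l.
Qed.

End constants.

Theorem proposition3p2 (R : realType) (X : completeNormedModType R)
    (gamma : probability (borel X) R) (Omega : set X)
    (sepX : separable_space X) (infX : ~ finite_dimensional X)
    (gaussX : centered_gaussian gamma) (ndegX : nondegenerate_gaussian gamma)
    (oO : open Omega) (cO : convex_set (Omega : set (convex_lmodType X)))
    (T : R -> (X -> R) -> X -> R) (TOU : OU_semigroup gamma oO T)
    (f g : X -> R) (fL2 : f \in Lfun (restr gamma oO) 2%:E)
    (gL2 : g \in Lfun (restr gamma oO) 2%:E)
    (t : R) (t0 : 0 <= t)
    (T1 : (X -> R) -> X -> R) (T1ext : L1_extension (restr gamma oO) (T t) T1) :
  {ae gamma, forall x, Omega x ->
    (T1 (fun y => f y * g y) x) ^+ 2 <=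
      T1 (fun y => f y ^+ 2) x * T1 (fun y => g y ^+ 2) x}.
Proof.
have [sgT genT] := TOU; have [contrT1 T1E] := T1ext.
have T1_cst1 : T1 (cst 1) = cst 1 %[ae restr gamma oO].
  have gen1 := (genT _ _).2 (OU_operator_cst gamma Omega oO 1).
  have [oneL _ _] := gen1; have fixT := generator_kernel_fixed sgT gen1 t0.
  by move: (T1E _ oneL) fixT; apply: filterS2 => x /= + + xT => /(_ xT) -> /(_ xT) ->.
(* A set null for the restricted measure is null once intersected with Omega. *)
have [N [mN N0 subN]] := @unital_Lcontraction_Cauchy_Schwarz _ _ _
  (mrestr gamma (borel_open oO)) _ contrT1 T1_cst1 f g fL2 gL2.
exists (N `&` Omega); split => //.
  by apply: measurableI => //; exact: borel_open.
by move=> x /= /not_implyP[xO ncs]; split => //; exact: subN.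
Qed.
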